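(* Let $q=p^k$ with $p$ an odd prime. Let $A,C\in\mathbb{F}_q$ with $C^2-C+1=0$, $A^3\neq -1$, and such that the polynomial $m_{A,C}(t)=Ct^3+A(C+1)t^2+A^2t-C\in\mathbb{F}_q[t]$ has no roots in $\mu_{q^2+q+1}$. Then $$f(x)=x^{q^2+q-1}+Ax^{q^2}+Cx$$ is a permutation polynomial of $\mathbb{F}_{q^3}$.
   Context: $\mu_{q^2+q+1}=\{x\in\mathbb{F}_{q^3}: x^{q^2+q+1}=1\}$. A polynomial $f\in\mathbb{F}_{q^3}[x]$ is a permutation polynomial of $\mathbb{F}_{q^3}$ if $c\mapsto f(c)$ is a bijection of $\mathbb{F}_{q^3}$. *)

(* Defs.v *)
From mathcomp Require Export all_boot all_order all_algebra all_field.

Set Implicit Arguments.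
Unset Strict Implicit.
Unset Printing Implicit Defensive.

Import GRing.Theory.
Local Open Scope ring_scope.

(* F plays the role of F_q (q = #|F|) and the cubic extension L that of
   F_{q^3}; scalars of F are viewed in L through in_alg L (a |-> a%:A). *)

Definition in_mu (F : finFieldType) (L : fieldExtType F) (x : L) : Prop :=
  x ^+ (#|F| ^ 2 + #|F| + 1)%N = 1.

Definition permutation_polynomial (R : nzRingType) (f : {poly R}) : Prop :=
  bijective (fun c : R => f.[c]).

Definition m_poly (F : fieldType) (A C : F) : {poly F} :=
  C *: 'X^3 + (A * (C + 1)) *: 'X^2 + (A ^+ 2) *: 'X - C%:P.

Definition f_poly (F : finFieldType) (L : fieldExtType F) (A C : F) : {poly L} :=
  'X^(#|F| ^ 2 + #|F| - 1)%N + (A%:A) *: 'X^(#|F| ^ 2)%N + (C%:A) *: 'X.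

(* Main.v *)
Require Import Defs.
From mathcomp Require Import ring.

Set Implicit Arguments.
Unset Strict Implicit.
Unset Printing Implicit Defensive.

Import GRing.Theory.
Local Open Scope ring_scope.

(** For [x <> 0] write [y = x^q] and [z = x^(q^2)], so that [f(x) = a] reads
    [yz + A zx + C x^2 = a x], together with its two Frobenius conjugates.
    In the coordinates [X = 1/x, Y = 1/y, Z = 1/z], the three conjugates of
    [f] are, up to the common factor [XYZ], the quadratic forms
    [X^2 + A XY + C YZ, Y^2 + A YZ + C ZX, Z^2 + A ZX + C XY].
    Because [C^2 - C + 1 = 0] these are the maximal minors of a 2x3 matrix of
    linear forms, hence satisfy two linear syzygies: they define a quadratic
    Cremona transformation of the plane. The syzygies determine [x : y] from
    [a], unless a quadratic expression in [a] and its conjugates vanishes, in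
    which case [- C a / a^(q^2)] is a root of [m_{A,C}] in [mu_{q^2+q+1}].
    So [f(x) = f(x')] makes [x'/x] invariant under Frobenius, and [f] commutes
    with multiplication by such elements. Finally a nonzero root [x] of [f]
    yields the root [y/x] of [m_{A,C}] in [mu_{q^2+q+1}]. *)

(** * The conjugate equations over an arbitrary field *)

Section ConjugateEquations.

Context {K : fieldType}.
Implicit Types A C a b c x y z : K.

Definition conj_form A C x y z : K := y * z + A * z * x + C * x ^+ 2.

(** The 2x2 minor, on the columns of [x * z] and [x * y], of the coefficient matrix of the two
    syzygies below, simplified by [C - C ^+ 2 = 1]. *)
Definition syzygy_minor A C a b c : K :=
  A * a * c - C * b * c - C ^+ 2 * a ^+ 2.

Lemma conj_form_syzygy1 A C a b c x y z :
  C ^+ 2 - C + 1 = 0 ->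
  a * x = conj_form A C x y z -> b * y = conj_form A C y z x ->
  c * z = conj_form A C z x y ->
  C ^+ 2 * b * (y * z) - C * c * (x * z) + a * (x * y) = 0.
Proof.
move=> hC ha hb hc.
transitivity (C ^+ 2 * z * (b * y) - C * x * (c * z) + y * (a * x)).
  by ring.
rewrite ha hb hc.
transitivity ((C ^+ 2 - C + 1) * (A * x * y * z + (C + 1) * y ^+ 2 * z)).
  by rewrite /conj_form; ring.
by rewrite hC mul0r.
Qed.

Lemma conj_form_syzygy2 A C a b c x y z :
  C ^+ 2 - C + 1 = 0 ->
  a * x = conj_form A C x y z -> b * y = conj_form A C y z x ->
  c * z = conj_form A C z x y ->
  - C * c * (y * z) + (C ^+ 2 * a - C * A * c) * (x * z)
    + (C * A * a + b) * (x * y) = 0.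
Proof.
move=> hC ha hb hc.
transitivity ((C ^+ 2 * z + C * A * y) * (a * x) + x * (b * y)
  - (C * y + C * A * x) * (c * z)); first by ring.
rewrite ha hb hc.
transitivity ((C ^+ 2 - C + 1) * ((C + 1) * x ^+ 2 * z + A * x ^+ 2 * y)).
  by rewrite /conj_form; ring.
by rewrite hC mul0r.
Qed.

Lemma conj_form_ratio A C a b c x y z :
  C ^+ 2 - C + 1 = 0 -> z != 0 ->
  a * x = conj_form A C x y z -> b * y = conj_form A C y z x ->
  c * z = conj_form A C z x y ->
  x * syzygy_minor A C a b c =
    - y * (C * a * c + C ^+ 2 * b * (C * A * a + b)).
Proof.
move=> hC z0 ha hb hc.
have h1 := conj_form_syzygy1 hC ha hb hc.
have h2 := conj_form_syzygy2 hC ha hb hc.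
apply: (mulfI z0); apply/eqP; rewrite -subr_eq0; apply/eqP.
(* This combination of the syzygies cancels [x * y], leaving a multiple of [z]; the last term
   accounts for the simplified form of the minor. *)
transitivity ((C * A * a + b)
  * (C ^+ 2 * b * (y * z) - C * c * (x * z) + a * (x * y))
  - a * (- C * c * (y * z) + (C ^+ 2 * a - C * A * c) * (x * z)
    + (C * A * a + b) * (x * y))
  + (C ^+ 2 - C + 1) * A * a * c * x * z).
  by rewrite /syzygy_minor; ring.
by rewrite h1 h2 hC; ring.
Qed.

(** Both forms are affine in [z]; eliminating [z] leaves the homogenised [m_poly A C] at [y / x]. *)
Lemma conj_form_eq0_cubic A C x y z :
  conj_form A C x y z = 0 -> conj_form A C y z x = 0 ->
  C * y ^+ 3 + A * (C + 1) * y ^+ 2 * x + A ^+ 2 * y * x ^+ 2 - C * x ^+ 3 = 0.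
Proof.
move=> h1 h2.
transitivity ((y + A * x) * conj_form A C y z x - x * conj_form A C x y z).
  by rewrite /conj_form; ring.
by rewrite h1 h2 !mulr0 subr0.
Qed.

(** Both minors are affine in [b]; eliminating [b] leaves, modulo [C ^+ 2 - C + 1], the homogenised
    [m_poly A C] at [- C * a / c]. *)
Lemma syzygy_minor_eq0_cubic A C a b c :
  C ^+ 2 - C + 1 = 0 ->
  syzygy_minor A C a b c = 0 -> syzygy_minor A C c a b = 0 ->
  C * (- C * a) ^+ 3 + A * (C + 1) * (- C * a) ^+ 2 * c
    + A ^+ 2 * (- C * a) * c ^+ 2 - C * c ^+ 3 = 0.
Proof.
move=> hC h1 h3.
transitivity (- C * (C * c * syzygy_minor A C c a b
    + (A * c - C * a) * syzygy_minor A C a b c)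
  - C * (C + 1) * (C ^+ 2 - C + 1) * c ^+ 3).
  by rewrite /syzygy_minor; ring.
by rewrite h1 h3 hC; ring.
Qed.

End ConjugateEquations.

(** * Frobenius on the cubic extension *)

Lemma expq_algF (F : finFieldType) (L : fieldExtType F) (a : F) :
  (a%:A : L) ^+ #|F| = a%:A.
Proof. by rewrite -in_algE -rmorphXn /= expf_card. Qed.

Lemma exprDq (F : finFieldType) (L : fieldExtType F) (u v : L) :
  (u + v) ^+ #|F| = u ^+ #|F| + v ^+ #|F|.
Proof.
have [p p_pr charFp] := finPcharP F.
have cardF : #|F| = (p ^ logn p #|F|)%N := card_pprimeChar charFp.
apply: exprDn_pchar; rewrite cardF pnatX; apply/orP; left.
by rewrite pnatE // (pchar_lalg L).
Qed.

Lemma expr_card_fieldExt (F : finFieldType) (L : fieldExtType F) (x : L) :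
  x ^+ (#|F| ^ \dim {:L}) = x.
Proof.
(* [finvect_type L] is [L] equipped with its finite structure, so that its cardinality makes
   sense. *)
have cardL := card_vspace {:finvect_type L}; rewrite card_vspacef in cardL.
by have := @expf_card (finvect_type L) x; rewrite cardL.
Qed.

Lemma expq3 (F : finFieldType) (L : fieldExtType F) (x : L) :
  \dim {:L} = 3%N -> ((x ^+ #|F|) ^+ #|F|) ^+ #|F| = x.
Proof.
move=> dimL; have := expr_card_fieldExt x.
by rewrite dimL !expnS expn0 muln1 !exprM.
Qed.

Lemma fieldExt_injective_bijective (F : finFieldType) (L : fieldExtType F)
  (g : L -> L) : injective g -> bijective g.
Proof. exact: (@injF_bij (finvect_type L)). Qed.

Lemma in_muM (F : finFieldType) (L : fieldExtType F) (u v : L) :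
  in_mu u -> in_mu v -> in_mu (u * v).
Proof. by rewrite /in_mu exprMn => -> ->; rewrite mulr1. Qed.

(** In degree 3 this product of conjugates is the norm to [F]. *)
Lemma in_muE (F : finFieldType) (L : fieldExtType F) (u : L) :
  in_mu u <-> (u ^+ #|F|) ^+ #|F| * u ^+ #|F| * u = 1.
Proof. by rewrite /in_mu !exprD expr1 expnSr expn1 exprM. Qed.

Lemma in_mu_algF (F : finFieldType) (L : fieldExtType F) (a : F) :
  a ^+ 3 = 1 -> in_mu (a%:A : L).
Proof.
move=> a3; apply/in_muE; rewrite !expq_algF -expr2 -exprSr.
by rewrite -in_algE -rmorphXn /= a3 scale1r.
Qed.

(** The easy half of Hilbert 90: Frobenius permutes the three conjugates of [w] cyclically, so the
    product telescopes. *)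
Lemma in_mu_expq_div (F : finFieldType) (L : fieldExtType F) (w : L) :
  \dim {:L} = 3%N -> w != 0 -> in_mu (w ^+ #|F| / w).
Proof.
move=> dimL w0; apply/in_muE; rewrite !expr_div_n expq3 //.
by field; rewrite w0 !expf_neq0.
Qed.

(** * The polynomial map *)

Lemma root_m_poly (F : fieldType) (L : fieldExtType F) (A C : F) (u v : L) :
  v != 0 ->
  C%:A * u ^+ 3 + A%:A * (C%:A + 1) * u ^+ 2 * v + A%:A ^+ 2 * u * v ^+ 2
    - C%:A * v ^+ 3 = 0 ->
  root (map_poly (in_alg L) (m_poly A C)) (u / v).
Proof.
move=> v0 h; rewrite /root /m_poly !(rmorphB, rmorphD) /= !linearZ /=.
rewrite !map_polyXn map_polyX map_polyC /=.
rewrite !(hornerD, hornerN, hornerZ, hornerXn, hornerX, hornerC).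
rewrite -!in_algE !(rmorphM, rmorphD, rmorph1) /= in h *.
apply/eqP; rewrite -[RHS](mul0r (v ^- 3)) -h.
by field.
Qed.

Lemma f_poly0 (F : finFieldType) (L : fieldExtType F) (A C : F) :
  (f_poly L A C).[0] = 0.
Proof.
have q1 := card_finNzRing_gt1 F.
rewrite /f_poly !hornerE !expr0n.
rewrite !gtn_eqF ?mulr0 ?addr0 // ?expn_gt0 ?(ltnW q1) //.
by rewrite -addnBA ?(ltnW q1) // ltn_addr // expn_gt0 (ltnW q1).
Qed.

Lemma f_polyE (F : finFieldType) (L : fieldExtType F) (A C : F) (x : L) :
  (f_poly L A C).[x] * x =
    conj_form A%:A C%:A x (x ^+ #|F|) ((x ^+ #|F|) ^+ #|F|).
Proof.
have q1 := card_finNzRing_gt1 F.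
rewrite /f_poly /conj_form !(hornerD, hornerZ, hornerXn, hornerX).
have -> : x ^+ #|F| * (x ^+ #|F|) ^+ #|F| = x ^+ (#|F| ^ 2 + #|F| - 1) * x.
  rewrite -exprSr -addn1 subnK ?addn_gt0 ?(ltnW q1) ?orbT //.
  by rewrite exprD mulrC expnSr expn1 exprM.
by rewrite -exprM mulnn; ring.
Qed.

Lemma conj_form_expq (F : finFieldType) (L : fieldExtType F) (A C : F)
  (x y z : L) :
  conj_form A%:A C%:A x y z ^+ #|F| =
    conj_form A%:A C%:A (x ^+ #|F|) (y ^+ #|F|) (z ^+ #|F|).
Proof.
by rewrite /conj_form !exprDq !exprMn !expq_algF.
Qed.

Lemma syzygy_minor_expq (F : finFieldType) (L : fieldExtType F) (A C : F)
  (a b c : L) :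
  syzygy_minor A%:A C%:A a b c ^+ #|F| =
    syzygy_minor A%:A C%:A (a ^+ #|F|) (b ^+ #|F|) (c ^+ #|F|).
Proof.
have exprBq u v : (u - v : L) ^+ #|F| = u ^+ #|F| - v ^+ #|F|.
  by apply/eqP; rewrite eq_sym subr_eq -exprDq subrK.
by rewrite /syzygy_minor !exprBq !exprMn !expq_algF.
Qed.

(** * Injectivity from the absence of roots in the norm-one group *)

Section Injectivity.

Context {F : finFieldType} {L : fieldExtType F} {A C : F}.
Hypothesis dimL : \dim {:L} = 3%N.
Hypothesis hC : C ^+ 2 - C + 1 = 0.
Hypothesis m_noroot : forall t : L,
  in_mu t -> ~ root (map_poly (in_alg L) (m_poly A C)) t.

Local Notation sigma x := (x ^+ #|F|).

Let hCL : (C%:A : L) ^+ 2 - C%:A + 1 = 0.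
Proof.
rewrite -in_algE -rmorphXn -rmorphB -(rmorph1 (in_alg L)) -rmorphD.
by rewrite hC rmorph0.
Qed.

Let expq0 : sigma (0 : L) = 0.
Proof. by rewrite expr0n gtn_eqF // (ltnW (card_finNzRing_gt1 F)). Qed.

Let sigma_neq0 (x : L) : x != 0 -> sigma x != 0.
Proof. exact: expf_neq0. Qed.

Lemma f_poly_neq0 (x : L) : x != 0 -> (f_poly L A C).[x] != 0.
Proof.
move=> x0; apply/eqP => fx.
have h1 : conj_form A%:A C%:A x (sigma x) (sigma (sigma x)) = 0.
  by rewrite -f_polyE fx mul0r.
have h2 : conj_form A%:A C%:A (sigma x) (sigma (sigma x)) x = 0.
  rewrite -{3}(expq3 x dimL) -conj_form_expq h1.
  by rewrite expq0.
apply: (m_noroot (in_mu_expq_div dimL x0)).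
exact: root_m_poly x0 (conj_form_eq0_cubic h1 h2).
Qed.

Lemma syzygy_minor_neq0 (a : L) :
  a != 0 -> syzygy_minor A%:A C%:A a (sigma a) (sigma (sigma a)) != 0.
Proof.
move=> a0; apply/eqP => h1.
set c := sigma (sigma a) in h1 *.
have c0 : c != 0 by do 2!apply: sigma_neq0.
have ac : a = sigma c by rewrite expq3.
(* Applying Frobenius twice to [h1] rotates the conjugates of [a]. *)
have h3 : syzygy_minor A%:A C%:A c a (sigma a) = 0.
  have := congr1 (fun u => sigma (sigma u)) h1.
  rewrite /= !syzygy_minor_expq /c !(expq3 _ dimL) => ->.
  by rewrite !expq0.
(* The norm of [- C] is its cube, and [C ^+ 3 + 1] is a multiple of [C ^+ 2 - C + 1]. *)
have C3 : (- C) ^+ 3 = 1.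
  apply/eqP; rewrite -subr_eq0; apply/eqP.
  transitivity (- (C ^+ 2 - C + 1) * (C + 1)); first by ring.
  by rewrite hC oppr0 mul0r.
apply: (m_noroot (in_muM (in_mu_algF L C3) (in_mu_expq_div dimL c0))).
rewrite mulrA -ac; apply: root_m_poly c0 _.
by rewrite scaleNr; exact: syzygy_minor_eq0_cubic hCL h1 h3.
Qed.

Lemma f_poly_ratio (x : L) (a := (f_poly L A C).[x]) : x != 0 ->
  x * syzygy_minor A%:A C%:A a (sigma a) (sigma (sigma a)) =
    - sigma x * (C%:A * a * sigma (sigma a)
      + C%:A ^+ 2 * sigma a * (C%:A * A%:A * a + sigma a)).
Proof.
move=> x0; have ha := f_polyE A C x; rewrite -/a in ha.
have hb := congr1 (fun u => sigma u) ha.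
rewrite conj_form_expq exprMn expq3 // in hb.
have hc := congr1 (fun u => sigma u) hb.
rewrite conj_form_expq !exprMn expq3 // in hc.
by apply: conj_form_ratio ha hb hc => //; do 2!apply: sigma_neq0.
Qed.

(** [conj_form] is homogeneous of degree 2, and all conjugates of [l * x] carry the same factor
    [l]. *)
Lemma f_poly_scale (l x : L) : sigma l = l -> x != 0 ->
  (f_poly L A C).[l * x] = l * (f_poly L A C).[x].
Proof.
move=> hl x0.
have [->|l0] := eqVneq l 0; first by rewrite !mul0r f_poly0.
apply: (mulIf (mulf_neq0 l0 x0)); rewrite f_polyE !exprMn !hl.
transitivity (l ^+ 2 * ((f_poly L A C).[x] * x)); last by ring.
by rewrite f_polyE /conj_form; ring.
Qed.

Lemma f_poly_inj : injective (fun x : L => (f_poly L A C).[x]).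
Proof.
move=> x x' /= exx'.
have [x0|x0] := eqVneq x 0.
  apply/eqP; rewrite x0 eq_sym; apply: contraT => /f_poly_neq0.
  by rewrite -exx' x0 f_poly0 eqxx.
have fx0 := f_poly_neq0 x0.
have x'0 : x' != 0.
  by apply: contra_neq fx0 => x'0; rewrite exx' x'0 f_poly0.
have M0 := syzygy_minor_neq0 fx0.
have h := f_poly_ratio x0.
have h' := f_poly_ratio x'0; rewrite -exx' in h'.
(* [h] and [h'] have the same coefficients, which depend only on the common value; [M0] allows
   cancelling. *)
have hxx' : sigma x * x' = x * sigma x'.
  apply: (mulIf M0); rewrite -mulrA h' [x * _]mulrC -[RHS]mulrA h; ring.
have hl : sigma (x' / x) = x' / x.
  rewrite expr_div_n; apply/eqP; rewrite eqr_div ?sigma_neq0 //.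
  by rewrite mulrC -hxx' mulrC.
(* The common value is nonzero and equals [x' / x] times itself, so the ratio is 1. *)
have := f_poly_scale hl x0; rewrite divfK // -exx' => /eqP.
rewrite -{1}[X in X == _]mul1r (inj_eq (mulIf fx0)) eq_sym => /eqP l1.
by rewrite -[x'](divfK x0) l1 mul1r.
Qed.

End Injectivity.

Theorem theorem3p4 (p k : nat) (F : finFieldType) (L : fieldExtType F)
    (A C : F) (p_prime : prime p) (p_odd : odd p)
    (cardF : #|F| = (p ^ k)%N)
    (dimL : \dim {: L} = 3%N)
    (hC : C ^+ 2 - C + 1 = 0)
    (hA : A ^+ 3 != -1)
    (m_noroot : forall t : L,
        in_mu t -> ~ root (map_poly (in_alg L) (m_poly A C)) t) :
  permutation_polynomial (f_poly L A C).
Proof. exact/fieldExt_injective_bijective/f_poly_inj. Qed.
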